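(* Let $z_\alpha$, for $\alpha$ ranging over all compositions of all $n\ge1$, be commuting indeterminates, and set $z_0=1$. Let $I\subseteq\mathbb{Q}[z_\alpha]$ be the ideal generated by: - $z_\alpha z_\beta-z_{\alpha\cdot\beta}-z_{\alpha\odot\beta}$ for all compositions $\alpha,\beta$; - the even Euler forms $\chi_{2m}=\sum_{r+s=2m}(-1)^r z_rz_s$ for $m\ge1$, where $r,s\ge0$ and $z_r$ is the indeterminate for the one-part composition $(r)$. Then the algebra homomorphism $\mathbb{Q}[z_\alpha]\to\mathbb{Q}\otimes_{\mathbb{Z}}\Omega$, $z_\alpha\mapsto\mathfrak{r}_\alpha$, induces an isomorphism of algebras $\mathbb{Q}[z_\alpha]/I\cong\mathbb{Q}\otimes\Omega$. Thus all relations amongst ribbon Schur $Q$-functions are generated by $\mathfrak{r}_\alpha\mathfrak{r}_\beta=\mathfrak{r}_{\alpha\cdot\beta}+\mathfrak{r}_{\alpha\odot\beta}$ and $\sum_{r+s=2m}(-1)^r\mathfrak{r}_r\mathfrak{r}_s=0$ for $m\ge1$ (with $\mathfrak{r}_0=1$).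
   Context: A composition $\alpha=\alpha_1\cdots\alpha_k$ is a finite sequence of positive integers. For compositions $\alpha=\alpha_1\cdots\alpha_k$ and $\beta=\beta_1\cdots\beta_l$, define $$\alpha\cdot\beta=\alpha_1\cdots\alpha_k\beta_1\cdots\beta_l,\qquad \alpha\odot\beta=\alpha_1\cdots\alpha_{k-1}(\alpha_k+\beta_1)\beta_2\cdots\beta_l.$$ These are the ribbon concatenation and near concatenation. A ribbon is a connected skew diagram (English convention) with no $2\times2$ block, and the ribbon $\alpha$ has $\alpha_i$ cells in its $i$-th row from the top. Set $q_0=1$ and $q_n=0$ for $n<0$. Here $q_n=Q_{(n)}$ is the skew Schur $Q$-function of a single row of $n$ cells: the sum over fillings of the row by the alphabet $1'<1<2'<2<\cdots$ that weakly increase and contain each primed letter at most once, of $\prod_i x_i^{(\#i+\#i')}$. Put $\Omega=\mathbb{Z}[q_1,q_2,\ldots]$. For a ribbon $\alpha$, realized as a skew diagram $\nu/\kappa$, the ribbon Schur $Q$-function is $\mathfrak{r}_\alpha=\det(q_{\nu_i-\kappa_j-i+j})_{i,j=1}^{\ell(\nu)}$. *)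

(* Defs.v *)
From HB Require Import structures.
From mathcomp Require Import all_boot all_order all_algebra finmap.
From mathcomp Require Import boolp.
From mathcomp Require Import monalg.
From mathcomp Require Import ring.

Set Implicit Arguments.
Unset Strict Implicit.
Unset Printing Implicit Defensive.

Import GRing.Theory Num.Theory.

Local Open Scope fset_scope.
Local Open Scope ring_scope.

Definition mdvd {I : choiceType} (d m : {cmonom I}) : bool :=
  mmul d (divcm m d) == m.

HB.lock Definition mdivs (I : choiceType) (m : {cmonom I}) :
    {fset {cmonom I}} :=
  [fset d in [seq [cmonom (e i : nat) | i : finsupp m]%M
                | e : {ffun finsupp m -> 'I_(mdeg m).+1}] | mdvd d m].

Section MonomialDivisors.
Context {I : choiceType}.
Implicit Types d m : {cmonom I}.

Lemma mdvdP d m : reflect (forall i, (d i <= m i)%N) (mdvd d m).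
Proof.
apply: (iffP (cmP _ _)) => h i.
  by rewrite -h cmM leq_addr.
by rewrite cmM divcmE subnKC.
Qed.

Lemma mdivsP d m : reflect (forall i, (d i <= m i)%N) (d \in mdivs m).
Proof.
rewrite mdivs.unlock !inE /=; apply: (iffP andP) => [[_ /mdvdP//]|dm].
split; last exact/mdvdP.
have ub (i : I) : (d i < (mdeg m).+1)%N.
  rewrite ltnS (leq_trans (dm i))//; case: (mdomP m i) => // im.
  by rewrite mdegE (big_fsetD1 i)//= leq_addr.
apply/mapP; exists [ffun i : finsupp m => Ordinal (ub (val i))].
  by rewrite mem_enum.
apply/eqP/cmP => i; rewrite cmE /= fsfun_ffun.
case: insubP => [u _ ui|].
  by rewrite /= ffunE /= ui.
by rewrite -cmE_eq0 => /eqP m0; apply/eqP; have := dm i; rewrite m0 leqn0.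
Qed.

Lemma mdivsE d m : (d \in mdivs m) = mdvd d m.
Proof. exact/mdivsP/mdvdP. Qed.

Lemma mdivs_divK d m : d \in mdivs m -> mmul d (divcm m d) = m.
Proof. by rewrite mdivsE => /eqP. Qed.

Lemma mul_divcmK d m : divcm (mmul d m) d = m.
Proof. by apply/eqP/cmP => i; rewrite divcmE cmM addKn. Qed.

Lemma mdivs_mul d m : d \in mdivs (mmul d m).
Proof. by apply/mdivsP => i; rewrite cmM leq_addr. Qed.

Lemma mdivs_div d m : d \in mdivs m -> divcm m d \in mdivs m.
Proof. by move=> _; apply/mdivsP => i; rewrite divcmE leq_subr. Qed.

Lemma divcm_divK d m : d \in mdivs m -> divcm m (divcm m d) = d.
Proof. by move=> /mdivsP h; apply/eqP/cmP => i; rewrite !divcmE subKn. Qed.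

End MonomialDivisors.

(* Formal power series over R in the variables x_i, i : I, given by their     *)
(* coefficients.                                                              *)
Definition pseries (I : choiceType) (R : Type) := {cmonom I} -> R.

Section PSeries.
Variables (I : choiceType) (R : comNzRingType).
Local Notation ps := (pseries I R).
Implicit Types (f g h : ps) (m d : {cmonom I}).

HB.instance Definition _ := gen_eqMixin ps.
HB.instance Definition _ := gen_choiceMixin ps.

Definition ps_zero : ps := fun=> 0.
Definition ps_opp f : ps := fun m => - f m.
Definition ps_add f g : ps := fun m => f m + g m.
Definition ps_one : ps := fun m => (m == mone)%:R.
Definition ps_mul f g : ps :=
  fun m => \sum_(d <- mdivs m) f d * g (divcm m d).
Definition ps_scale (c : R) f : ps := fun m => c * f m.

Lemma psP f g : (forall m, f m = g m) -> f = g.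
Proof. exact: funext. Qed.

Lemma ps_addA : associative ps_add.
Proof. by move=> f g h; apply: psP => m; rewrite /ps_add addrA. Qed.
Lemma ps_addC : commutative ps_add.
Proof. by move=> f g; apply: psP => m; rewrite /ps_add addrC. Qed.
Lemma ps_add0 : left_id ps_zero ps_add.
Proof. by move=> f; apply: psP => m; rewrite /ps_add add0r. Qed.
Lemma ps_addN : left_inverse ps_zero ps_opp ps_add.
Proof. by move=> f; apply: psP => m; rewrite /ps_add addNr. Qed.

HB.instance Definition _ :=
  GRing.isZmodule.Build ps ps_addA ps_addC ps_add0 ps_addN.

Lemma ps_mulC : commutative ps_mul.
Proof.
move=> f g; apply: psP => m; rewrite /ps_mul.
have E : mdivs m = [fset divcm m d | d in mdivs m].
  apply/fsetP => d; apply/idP/imfsetP => [dm|[e /= em ->]].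
    by exists (divcm m d); rewrite /= ?mdivs_div ?divcm_divK.
  exact: mdivs_div.
rewrite [in LHS]E big_imfset /=; last first.
  by move=> d e dm em /(congr1 (divcm m)); rewrite !divcm_divK.
by rewrite big_seq [RHS]big_seq; apply: eq_bigr => d dm;
  rewrite divcm_divK// mulrC.
Qed.

Lemma ps_mul1 : left_id ps_one ps_mul.
Proof.
move=> f; apply: psP => m; rewrite /ps_mul (big_fsetD1 mone)/=; last first.
  by apply/mdivsP => i; rewrite cm1.
rewrite big1_fset ?addr0 => [|d]; last first.
  by rewrite in_fsetD1 => /andP[/negPf dn _] _; rewrite /ps_one dn mul0r.
rewrite /ps_one eqxx mul1r; congr f.
by apply/eqP/cmP => i; rewrite divcmE cm1 subn0.
Qed.

Lemma ps_mulDl : left_distributive ps_mul ps_add.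
Proof.
move=> f g h; apply: psP => m; rewrite /ps_mul /ps_add -big_split/=.
by apply: eq_bigr => d _; rewrite mulrDl.
Qed.

Lemma ps_mulA : associative ps_mul.
Proof.
move=> f g h; apply: psP => m; rewrite /ps_mul; apply/esym.
under eq_bigr do rewrite mulr_suml.
pose F e d := f e * g (divcm d e) * h (divcm m d).
transitivity (\sum_(d <- mdivs m) \sum_(e <- mdivs m | e \in mdivs d) F e d).
  rewrite big_seq [RHS]big_seq; apply: eq_bigr => d dm.
  rewrite [RHS]big_fset_condE; apply: eq_fbigl => e; rewrite !inE/=.
  apply/idP/andP => [ed|[_ //]]; split=> //.
  by apply/mdivsP => i; apply: leq_trans (mdivsP _ _ dm i); apply/mdivsP: i.
rewrite (exchange_big_dep predT)//= big_seq [RHS]big_seq.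
apply: eq_bigr => e em; rewrite mulr_sumr [LHS]big_fset_condE.
have -> : [fset d | d in mdivs m & e \in mdivs d]
        = [fset mmul e k | k in mdivs (divcm m e)].
  apply/fsetP => d; rewrite !inE/=; apply/andP/imfsetP => /=.
    move=> [dm ed]; exists (divcm d e); last by rewrite mdivs_divK.
    by apply/mdivsP => i; rewrite !divcmE leq_sub2r// (mdivsP _ _ dm i).
  move=> [k km ->]; rewrite mdivs_mul; split=> //; apply/mdivsP => i.
  have := mdivsP _ _ km i; rewrite divcmE cmM => ki.
  by rewrite -(subnKC (mdivsP _ _ em i)) leq_add2l.
rewrite big_imfset/=; last first.
  by move=> k l _ _ /(congr1 (fun x => divcm (x : {cmonom I}) (e : {cmonom I}))); rewrite !mul_divcmK.
apply: eq_bigr => k _; rewrite /F mul_divcmK mulrA; congr (_ * h _).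
by apply/eqP/cmP => i; rewrite !divcmE cmM subnDA.
Qed.

Lemma ps_one_neq0 : ps_one != 0.
Proof.
apply/eqP => /(congr1 (fun f : ps => f mone)); rewrite /ps_one eqxx.
by move/eqP; rewrite oner_eq0.
Qed.

HB.instance Definition _ := GRing.Zmodule_isComNzRing.Build ps
  ps_mulA ps_mulC ps_mul1 ps_mulDl ps_one_neq0.

Lemma ps_scaleA a b f : ps_scale a (ps_scale b f) = ps_scale (a * b) f.
Proof. by apply: psP => m; rewrite /ps_scale mulrA. Qed.
Lemma ps_scale1 : left_id 1 ps_scale.
Proof. by move=> f; apply: psP => m; rewrite /ps_scale mul1r. Qed.
Lemma ps_scaleDr : right_distributive ps_scale +%R.
Proof. by move=> c f g; apply: psP => m; rewrite /ps_scale mulrDr. Qed.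
Lemma ps_scaleDl f : {morph ps_scale^~ f : a b / a + b}.
Proof. by move=> a b; apply: psP => m; rewrite /ps_scale mulrDl. Qed.

HB.instance Definition _ := GRing.Zmodule_isLmodule.Build R ps
  ps_scaleA ps_scale1 ps_scaleDr ps_scaleDl.

Lemma ps_scaleAl c f g : c *: (f * g) = (c *: f) * g.
Proof.
apply: psP => m; change (c * ps_mul f g m = ps_mul (ps_scale c f) g m).
rewrite /ps_mul /ps_scale.
by rewrite mulr_sumr; apply: eq_bigr => d _; rewrite mulrA.
Qed.

HB.instance Definition _ := GRing.Lmodule_isLalgebra.Build R ps ps_scaleAl.
HB.instance Definition _ := GRing.Lalgebra_isComAlgebra.Build R ps.

End PSeries.

Section PSeriesMap.
Variables (I : choiceType) (R S : comNzRingType) (u : {rmorphism R -> S}).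

Definition ps_map (f : pseries I R) : pseries I S := fun m => u (f m).

Lemma ps_map_zmod_morphism : zmod_morphism ps_map.
Proof. by move=> f g; apply: psP => m; rewrite /ps_map rmorphB. Qed.

Lemma ps_map_monoid_morphism : monoid_morphism ps_map.
Proof.
split=> [|f g]; apply: psP => m; rewrite /ps_map.
  by rewrite rmorph_nat.
by rewrite rmorph_sum; apply: eq_bigr => d _; rewrite rmorphM.
Qed.

HB.instance Definition _ := GRing.isZmodMorphism.Build _ _ ps_map
  ps_map_zmod_morphism.
HB.instance Definition _ := GRing.isMonoidMorphism.Build _ _ ps_map
  ps_map_monoid_morphism.

End PSeriesMap.

(* A letter (i, true) stands for the primed letter i' and (i, false) for i, so *)
(* that the alphabet is ordered by 0' < 0 < 1' < 1 < ...; the variables are   *)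
(* x_0, x_1, ...                                                              *)
Definition letter := (nat * bool)%type.

Definition le_letter (x y : letter) : bool :=
  (x.1 < y.1)%N || (x.1 == y.1) && (y.2 ==> x.2).

Definition row_filling (w : seq letter) : bool :=
  sorted le_letter w && all (fun x => x.2 ==> (count_mem x w <= 1)%N) w.

Definition weight (w : seq letter) : {cmonom nat} :=
  \big[mmul/mone]_(x <- w) ucm x.1.

(* The coefficient of x^m counts the fillings of weight m; their letters lie  *)
(* over the support of m, so it suffices to count words in these letters; see *)
(* qrow_count.                                                                *)
Definition qrow (n : nat) : pseries nat int := fun m =>
  #|[set w : n.-tuple (finsupp m * bool)
      | let w' := [seq (val x.1, x.2) | x <- w] in
        row_filling w' && (weight w' == m)]|%:Z.

Lemma weight_letter (w : seq letter) x : x \in w -> x.1 \in finsupp (weight w).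
Proof.
rewrite /weight; elim: w => // y w IH; rewrite inE big_cons mdomD inE.
by case/orP => [/eqP ->|/IH ->]; rewrite ?orbT// mdomU inE eqxx.
Qed.

Lemma qrow_count n m (s : seq (seq letter)) : uniq s ->
  (forall w, (w \in s) = [&& size w == n, row_filling w & weight w == m]) ->
  qrow n m = (size s)%:Z.
Proof.
move=> us sP; rewrite /qrow; congr Posz; rewrite cardE.
pose f (w : n.-tuple (finsupp m * bool)) : seq letter :=
  [seq (val x.1, x.2) | x <- w].
have f_inj : injective f.
  move=> v w vw; apply/val_inj/(inj_map _ vw).
  by move=> [x b] [y c] /= [/val_inj -> ->].
rewrite -(size_map f); apply/perm_size/uniq_perm => //.
  by rewrite map_inj_uniq// enum_uniq.
move=> w; rewrite sP; apply/mapP/and3P => [[v]|[/eqP sw fw /eqP ww]].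
  by rewrite mem_enum inE => /andP[fv wv] ->; rewrite size_map size_tuple.
have [v vw] : exists v : seq (finsupp m * bool),
    [seq (val x.1, x.2) | x <- v] = w.
  have : {in w, forall x, x.1 \in finsupp m}.
    by move=> x /weight_letter; rewrite ww.
  elim: w {sw fw ww} => [|x w IH] xw; first by exists [::].
  have [v <-] := IH (fun y yw => xw y (mem_behead (s := x :: w) yw)).
  have x1 := xw x (mem_head _ _).
  by exists (([` x1], x.2) :: v); case: x {xw} x1.
have sv : size v == n by rewrite -sw -vw size_map.
exists (Tuple sv); last by rewrite /f.
by rewrite mem_enum inE /= vw fw ww eqxx.
Qed.

Inductive subring_gen (R : nzRingType) (G : R -> Prop) : R -> Prop :=
| subring_gen_in x : G x -> subring_gen G x
| subring_gen1 : subring_gen G 1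
| subring_genB x y : subring_gen G x -> subring_gen G y -> subring_gen G (x - y)
| subring_genM x y : subring_gen G x -> subring_gen G y -> subring_gen G (x * y).

Definition omega_pred : pred (pseries nat int) :=
  fun f => `[< subring_gen (fun g => exists n, g = qrow n.+1) f >].

Lemma omega_subring_closed : subring_closed omega_pred.
Proof.
split=> [|f g|f g]; rewrite !unfold_in.
- exact/asboolP/subring_gen1.
- by move=> /asboolP ? /asboolP ?; apply/asboolP/subring_genB.
- by move=> /asboolP ? /asboolP ?; apply/asboolP/subring_genM.
Qed.

HB.instance Definition _ :=
  GRing.isSubringClosed.Build _ omega_pred omega_subring_closed.

Record Omega := MkOmega { omega_val : pseries nat int;
                          omega_valP : omega_val \in omega_pred }.

HB.instance Definition _ := [isSub for omega_val].
HB.instance Definition _ := [Choice of Omega by <:].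
HB.instance Definition _ := [SubChoice_isSubComNzRing of Omega by <:].

Lemma qrow_omega n : qrow n.+1 \in omega_pred.
Proof. by apply/asboolP/subring_gen_in; exists n. Qed.

Definition qfun (k : int) : Omega :=
  match k with
  | Posz 0 => 1
  | Posz n.+1 => MkOmega (qrow_omega n)
  | Negz _ => 0
  end.

(* Q (x) Omega is realized as the Q-span of Omega in the power series over Q; *)
(* OmegaQ_base_change below is its universal property as a base change.       *)
Definition omega_emb (w : Omega) : pseries nat rat :=
  ps_map (intr : {rmorphism int -> rat}) (val w).

Definition omegaQ_pred : pred (pseries nat rat) := fun f =>
  `[< exists s : seq (rat * Omega), f = \sum_(x <- s) x.1 *: omega_emb x.2 >].

Lemma omega_emb_zmod_morphism : zmod_morphism omega_emb.
Proof. by move=> v w; rewrite /omega_emb !rmorphB. Qed.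
Lemma omega_emb_monoid_morphism : monoid_morphism omega_emb.
Proof. by split=> [|v w]; rewrite /omega_emb ?rmorph1 ?rmorphM. Qed.

HB.instance Definition _ :=
  GRing.isZmodMorphism.Build _ _ omega_emb omega_emb_zmod_morphism.
HB.instance Definition _ :=
  GRing.isMonoidMorphism.Build _ _ omega_emb omega_emb_monoid_morphism.

Lemma omega_emb_inj : injective omega_emb.
Proof.
move=> v w /(congr1 (fun f : pseries nat rat => f _)) vw.
apply/val_inj/psP => m; exact: (intr_inj (vw m)).
Qed.

Lemma omegaQ_fracP f :
  reflect (exists N (w : Omega), f = N.+1%:R^-1 *: omega_emb w)
          (f \in omegaQ_pred).
Proof.
apply: (iffP (asboolP _)) => [[s ->]|[N [w ->]]]; last first.
  by exists [:: (N.+1%:R^-1, w)]; rewrite big_seq1.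
elim: s => [|[c v] s [N [w IH]]].
  by exists 0, 0; rewrite big_nil rmorph0 scaler0.
rewrite big_cons IH /=.
have [M dM] : exists M, denq c = M.+1%:Z.
  by have := denq_gt0 c; case: (denq c) => [[|M]|] // _; exists M.
exists (M.+1 * N.+1).-1, (v *~ numq c *+ N.+1 + w *+ M.+1).
rewrite prednK ?muln_gt0// rmorphD rmorphMn rmorphMz rmorphMn /=.
rewrite -!scaler_nat -scaler_int scalerDr !scalerA natrM.
rewrite -[c in LHS]divq_num_den dM -pmulrn.
have nz k : k.+1%:R != 0 :> rat by rewrite pnatr_eq0.
by congr (_ *: _ + _ *: _); field; rewrite !nat1r !nz.
Qed.

Lemma omegaQ_subalg_closed : subalg_closed omegaQ_pred.
Proof.
split=> [|c f g|f g].
- by apply/asboolP; exists [:: (1, 1)]; rewrite big_seq1 /= rmorph1 scale1r.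
- move=> /asboolP[s ->] /asboolP[t ->]; apply/asboolP.
  exists ([seq (c * x.1, x.2) | x <- s] ++ t).
  rewrite big_cat big_map scaler_sumr /=; congr (_ + _).
  by apply: eq_bigr => x _; rewrite scalerA.
- move=> /omegaQ_fracP[N [v ->]] /omegaQ_fracP[M [w ->]]; apply/asboolP.
  exists [:: (N.+1%:R^-1 * M.+1%:R^-1, v * w)].
  by rewrite big_seq1 rmorphM -scalerAl -scalerAr scalerA.
Qed.

HB.instance Definition _ :=
  GRing.isSubalgClosed.Build _ _ omegaQ_pred omegaQ_subalg_closed.

Record OmegaQ := MkOmegaQ { omegaQ_val : pseries nat rat;
                            omegaQ_valP : omegaQ_val \in omegaQ_pred }.

HB.instance Definition _ := [isSub for omegaQ_val].
HB.instance Definition _ := [Choice of OmegaQ by <:].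
HB.instance Definition _ := [SubChoice_isSubAlgebra of OmegaQ by <:].
HB.instance Definition _ := GRing.SubNzRing_isSubComNzRing.Build _ _ OmegaQ.


Lemma omega_emb_omegaQ w : omega_emb w \in omegaQ_pred.
Proof. by apply/asboolP; exists [:: (1, w)]; rewrite big_seq1 scale1r. Qed.

(* w |-> 1 (x) w *)
Definition omegaQ_of (w : Omega) : OmegaQ := MkOmegaQ (omega_emb_omegaQ w).

Lemma omegaQ_of_zmod_morphism : zmod_morphism omegaQ_of.
Proof. by move=> v w; apply: val_inj; rewrite /= rmorphB. Qed.
Lemma omegaQ_of_monoid_morphism : monoid_morphism omegaQ_of.
Proof. by split=> [|v w]; apply: val_inj; rewrite /= ?rmorph1 ?rmorphM. Qed.

HB.instance Definition _ :=
  GRing.isZmodMorphism.Build _ _ omegaQ_of omegaQ_of_zmod_morphism.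
HB.instance Definition _ :=
  GRing.isMonoidMorphism.Build _ _ omegaQ_of omegaQ_of_monoid_morphism.

Lemma OmegaQ_fracP (x : OmegaQ) :
  exists N (w : Omega), x = N.+1%:R^-1 *: omegaQ_of w.
Proof.
have /omegaQ_fracP[N [w xw]] := omegaQ_valP x; exists N, w.
by apply: val_inj; rewrite linearZ.
Qed.

Lemma OmegaQ_base_change (B : comAlgType rat) (j : {rmorphism Omega -> B}) :
  exists2 g : {lrmorphism OmegaQ -> B}, (forall w, g (omegaQ_of w) = j w) &
    forall g' : {lrmorphism OmegaQ -> B},
      (forall w, g' (omegaQ_of w) = j w) -> g' =1 g.
Proof.
have nz k : k.+1%:R != 0 :> rat by rewrite pnatr_eq0.
pose P (x : OmegaQ) (Nw : nat * Omega) :=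
  x = Nw.1.+1%:R^-1 *: omegaQ_of Nw.2.
have /choice[F FP] : forall x, exists Nw, P x Nw.
  by move=> x; have [N [w ?]] := OmegaQ_fracP x; exists (N, w).
pose g x : B := (F x).1.+1%:R^-1 *: j (F x).2.
have gE N w : g (N.+1%:R^-1 *: omegaQ_of w) = N.+1%:R^-1 *: j w.
  rewrite /g; have := FP (N.+1%:R^-1 *: omegaQ_of w); rewrite /P.
  case: (F _) => M v /= E.
  have {}E : w *+ M.+1 = v *+ N.+1.
    apply: omega_emb_inj; have := congr1 (fun x => (N.+1%:R * M.+1%:R) *: val x) E.
    rewrite !linearZ /= !scalerA mulKf// mulrCA mulVf// mulr1 => {}E.
    by rewrite !rmorphMn /= -!scaler_nat.
  have {}E := congr1 j E; rewrite !rmorphMn /= -!scaler_nat in E.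
  apply: (@scalerI _ _ (N.+1%:R * M.+1%:R)); first by rewrite mulf_neq0.
  by rewrite !scalerA mulfK// mulrAC mulfV// mul1r.
have gB : zmod_morphism g.
  move=> x y; have [N [v ->]] := OmegaQ_fracP x.
  have [M [w ->]] := OmegaQ_fracP y.
  have -> : N.+1%:R^-1 *: omegaQ_of v - M.+1%:R^-1 *: omegaQ_of w =
     (N.+1 * M.+1).-1.+1%:R^-1 *: omegaQ_of (v *+ M.+1 - w *+ N.+1).
    rewrite prednK ?muln_gt0// rmorphB !rmorphMn /= -!scaler_nat scalerBr.
    by rewrite !scalerA natrM; congr (_ *: _ - _ *: _); field; rewrite !nat1r !nz.
  rewrite !gE prednK ?muln_gt0// rmorphB !rmorphMn /= -!scaler_nat scalerBr.
  by rewrite !scalerA natrM; congr (_ *: _ - _ *: _); field; rewrite !nat1r !nz.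
have gM : monoid_morphism g.
  split=> [|x y].
    by have := gE 0%N 1; rewrite !rmorph1 invr1 !scale1r.
  have [N [v ->]] := OmegaQ_fracP x; have [M [w ->]] := OmegaQ_fracP y.
  rewrite -scalerAl -scalerAr scalerA -invfM -natrM -rmorphM.
  have := gE (N.+1 * M.+1).-1 (v * w); rewrite prednK ?muln_gt0// => ->.
  by rewrite !gE rmorphM -scalerAl -scalerAr scalerA -invfM -natrM.
have gZ : scalable g.
  move=> c x; have [N [v ->]] := OmegaQ_fracP x.
  have [M dM] : exists M, denq c = M.+1%:Z.
    by have := denq_gt0 c; case: (denq c) => [[|M]|] // _; exists M.
  have -> : c *: (N.+1%:R^-1 *: omegaQ_of v) =
      (N.+1 * M.+1).-1.+1%:R^-1 *: omegaQ_of (v *~ numq c).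
    rewrite prednK ?muln_gt0// rmorphMz /= -!scaler_int !scalerA natrM.
    by congr (_ *: _); rewrite -[c in LHS]divq_num_den dM -pmulrn; field;
      rewrite !nat1r !nz.
  rewrite !gE prednK ?muln_gt0// rmorphMz /= -!scaler_int !scalerA natrM.
  by congr (_ *: _); rewrite -[c in RHS]divq_num_den dM -pmulrn; field;
    rewrite !nat1r !nz.
pose gA := GRing.isZmodMorphism.Build OmegaQ B g gB.
pose gMm := GRing.isMonoidMorphism.Build OmegaQ B g gM.
pose gSc := GRing.isScalable.Build rat OmegaQ B *:%R g gZ.
pose G : {lrmorphism OmegaQ -> B} := HB.pack g gA gMm gSc.
exists G => [w|g' g'j x].
  by have := gE 0%N w; rewrite invr1 !scale1r.
have [N [w ->]] := OmegaQ_fracP x.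
by rewrite linearZ /= g'j; apply/esym/gE.
Qed.

Definition is_comp (s : seq nat) : bool := (s != [::]) && all (ltn 0) s.

Record composition := MkComposition { composition_seq :> seq nat; composition_seqP : is_comp composition_seq }.

HB.instance Definition _ := [isSub for composition_seq].
HB.instance Definition _ := [Countable of composition by <:].

Lemma is_comp1 n : is_comp [:: n.+1].
Proof. by []. Qed.

Definition comp1 n : composition := MkComposition (is_comp1 n).

Definition ncat (s t : seq nat) : seq nat :=
  take (size s).-1 s ++ (last 0 s + head 0 t)%N :: behead t.

Lemma is_comp_cat (a b : composition) : is_comp (a ++ b).
Proof.
case: a b => [[|x s] //= sP] [t tP]; rewrite /is_comp /= all_cat.
by case/andP: sP => _ /= /andP[-> ->]; case/andP: tP.
Qed.

Lemma is_comp_ncat (a b : composition) : is_comp (ncat a b).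
Proof.
case: a b => [s /andP[s0 sP]] [[|y t] //= /andP[_ /= /andP[y0 tP]]].
rewrite /is_comp /ncat /= -size_eq0 size_cat addnS /= all_cat /= tP andbT.
rewrite addn_gt0 y0 orbT andbT.
by apply/allP => x /mem_take xs; apply: (allP sP).
Qed.

Definition cconc (a b : composition) : composition := MkComposition (is_comp_cat a b).
Definition nconc (a b : composition) : composition := MkComposition (is_comp_ncat a b).

(* The ribbon with row lengths s, from top to bottom, is nu/kappa for         *)
(* nu = ribbon_outer s and kappa = ribbon_inner s: consecutive rows overlap in *)
(* exactly one column, and the last row starts in the first column; see       *)
(* ribbon_rows, ribbon_overlap and ribbon_last.                               *)
Fixpoint ribbon_outer (s : seq nat) : seq nat :=
  if s is a :: s' then
    (a + (head 1 (ribbon_outer s')).-1)%N :: ribbon_outer s'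
  else [::].

Fixpoint ribbon_inner (s : seq nat) : seq nat :=
  if s is a :: s' then
    (head 1 (ribbon_outer s')).-1%N :: ribbon_inner s'
  else [::].

Lemma size_ribbon_outer s : size (ribbon_outer s) = size s.
Proof. by elim: s => //= a s ->. Qed.

Lemma size_ribbon_inner s : size (ribbon_inner s) = size s.
Proof. by elim: s => //= a s ->. Qed.

Lemma ribbon_rows s i :
  nth 0%N (ribbon_outer s) i = (nth 0%N (ribbon_inner s) i + nth 0%N s i)%N.
Proof. by elim: s i => [|a s IH] [|i] //=; rewrite addnC. Qed.

Lemma ribbon_overlap (a : composition) i : (i.+1 < size a)%N ->
  nth 0%N (ribbon_outer a) i.+1 = (nth 0%N (ribbon_inner a) i).+1.
Proof.
case: a => s /= /andP[_]; elim: s i => [|x s IH] [|i] //=; last first.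
  by move=> /andP[_ /IH]; apply.
by case: s {IH} => [|y s] //= /and3P[_]; case: y.
Qed.

Lemma ribbon_last s : last 0%N (ribbon_inner s) = 0%N.
Proof.
elim: s => //= a [|b s] // IH.
Qed.

Definition skew_det (nu kappa : seq nat) : Omega :=
  \det (\matrix_(i < size nu, j < size nu)
          qfun ((nth 0%N nu i)%:Z - (nth 0%N kappa j)%:Z - i%:Z + j%:Z)).

Definition ribbonQ (a : composition) : Omega :=
  skew_det (ribbon_outer a) (ribbon_inner a).

Definition ribbonQ_row (r : nat) : Omega :=
  if r is n.+1 then ribbonQ (comp1 n) else 1.

Notation zpoly := {malg rat[{cmonom composition}]}.

HB.lock Definition zvar (a : composition) : zpoly := << ucm a >>.

Definition zvar_row (r : nat) : zpoly := if r is n.+1 then zvar (comp1 n) else 1.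

Definition euler_form (n : nat) : zpoly :=
  \sum_(r < n.+1) (-1) ^+ r * zvar_row r * zvar_row (n - r).

Inductive ideal_gen (R : comNzRingType) (G : R -> Prop) : R -> Prop :=
| ideal_gen_in x : G x -> ideal_gen G x
| ideal_gen0 : ideal_gen G 0
| ideal_genD x y : ideal_gen G x -> ideal_gen G y -> ideal_gen G (x + y)
| ideal_genM a x : ideal_gen G x -> ideal_gen G (a * x).

Inductive ribbon_relation : zpoly -> Prop :=
| ribbon_relation_mul a b :
    ribbon_relation (zvar a * zvar b - zvar (cconc a b) - zvar (nconc a b))
| ribbon_relation_euler m : (0 < m)%N -> ribbon_relation (euler_form (2 * m)).

Definition ribbon_ideal : pred zpoly :=
  fun p => `[< ideal_gen ribbon_relation p >].

Section Augmentation.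
Variable e : {rmorphism zpoly -> rat}.
Hypothesis ez : forall a, e (zvar a) = 0.

Lemma aug_relation p : ribbon_relation p -> e p = 0.
Proof.
case=> [a b|m m0].
  by rewrite 2!rmorphB rmorphM (ez a) (ez b) (ez (cconc _ _)) (ez (nconc _ _))
    mul0r !subr0.
case: m m0 => // m _; rewrite /euler_form rmorph_sum big1// => r _.
rewrite -mulrA 2!rmorphM.
case: (nat_of_ord r) => [|n]; last by rewrite (ez (comp1 n)) mul0r mulr0.
rewrite subn0 mul2n doubleS.
by rewrite (ez (comp1 _)) !mulr0.
Qed.

Lemma aug_ideal p : ideal_gen ribbon_relation p -> e p = 0.
Proof.
elim=> [x|||].
- exact: aug_relation.
- exact: rmorph0.
- by move=> x y _ hx _ hy; rewrite rmorphD hx hy addr0.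
- by move=> a x _ hx; rewrite rmorphM hx mulr0.
Qed.
End Augmentation.

Lemma mcoeff1_z a : mcoeff mone (zvar a) = 0.
Proof. by rewrite zvar.unlock [LHS]mcoeffU1 cm1_eq1. Qed.

Lemma ribbon_ideal_closed : idealr_closed ribbon_ideal.
Proof.
split=> [||a p r].
- exact/asboolP/ideal_gen0.
- apply/asboolP => /(aug_ideal mcoeff1_z) /eqP.
  by rewrite rmorph1 oner_eq0.
- move=> /asboolP hp /asboolP hr; apply/asboolP/ideal_genD => //.
  exact: ideal_genM.
Qed.

HB.instance Definition _ := isIdealr.Build zpoly ribbon_ideal
  ribbon_ideal_closed.

Section QuotientAlgebra.
Variables (K : comNzRingType) (A : comAlgType K) (J : idealr A).
Local Notation quot := {ideal_quot J}.
Local Open Scope quotient_scope.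

Definition quot_scale (c : K) (x : quot) : quot := \pi_quot (c *: repr x).

Lemma pi_scale c (p : A) : quot_scale c (\pi_quot p) = \pi_quot (c *: p).
Proof.
apply/eqP; rewrite /quot_scale -Quotient.idealrBE -scalerBr -mulr_algl.
by apply: idealMr; rewrite Quotient.idealrBE reprK.
Qed.

Lemma quot_scaleA a b x : quot_scale a (quot_scale b x) = quot_scale (a * b) x.
Proof.
elim/quotW: x => p.
by rewrite (pi_scale b p) (pi_scale a (b *: p)) (pi_scale _ p) scalerA.
Qed.
Lemma quot_scale1 : left_id 1 quot_scale.
Proof. by elim/quotW => p; rewrite (pi_scale 1 p) scale1r. Qed.
Lemma quot_scaleDr : right_distributive quot_scale +%R.
Proof.
move=> c; elim/quotW => p; elim/quotW => r; rewrite -raddfD.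
by rewrite (pi_scale c p) (pi_scale c r) (pi_scale c (p + r)) -raddfD scalerDr.
Qed.
Lemma quot_scaleDl x : {morph quot_scale^~ x : a b / a + b}.
Proof.
move=> a b; elim/quotW: x => p.
by rewrite (pi_scale a p) (pi_scale b p) (pi_scale _ p) -raddfD scalerDl.
Qed.

HB.instance Definition _ := GRing.Zmodule_isLmodule.Build K quot
  quot_scaleA quot_scale1 quot_scaleDr quot_scaleDl.

Lemma quot_scaleAl c (x y : quot) : c *: (x * y) = (c *: x) * y.
Proof.
elim/quotW: x => p; elim/quotW: y => r; rewrite -rmorphM.
rewrite -![c *: \pi_quot _]/(quot_scale _ _).
by rewrite (pi_scale c (p * r)) (pi_scale c p) scalerAl -rmorphM.
Qed.

HB.instance Definition _ := GRing.Lmodule_isLalgebra.Build K quot quot_scaleAl.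
HB.instance Definition _ := GRing.Lalgebra_isComAlgebra.Build K quot.
End QuotientAlgebra.

Section Evaluation.
Variables (I : choiceType) (K : comNzRingType) (A : comAlgType K) (v : I -> A).

Definition monom_eval (m : {cmonom I}) : A :=
  \prod_(i <- finsupp m) v i ^+ m i.

Lemma monom_evalEw (m : {cmonom I}) (d : {fset I}) : finsupp m `<=` d ->
  monom_eval m = \prod_(i <- d) v i ^+ m i.
Proof.
move=> le; rewrite /monom_eval (big_fset_incl _ le)// => i _.
by rewrite -cmE_eq0 => /eqP ->; rewrite expr0.
Qed.

Lemma monom_eval_mmorphism : mmorphism monom_eval.
Proof.
split=> [m n|]; last by rewrite /monom_eval mdom1 big_seq_fset0.
pose d := finsupp m `|` finsupp n.
rewrite (@monom_evalEw m d) ?fsubsetUl// (@monom_evalEw n d) ?fsubsetUr//.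
rewrite /monom_eval mdomD; under eq_bigr do rewrite cmM exprD.
exact: big_split.
Qed.

HB.instance Definition _ := isMultiplicative.Build _ _ monom_eval
  monom_eval_mmorphism.

Definition poly_eval (p : {malg K[{cmonom I}]}) : A :=
  mmap (in_alg A) monom_eval p.

Lemma poly_eval_scalable : scalable poly_eval.
Proof.
by move=> c p; rewrite /poly_eval mmapZ /= mulr_algl.
Qed.

HB.instance Definition _ := GRing.RMorphism.copy poly_eval
  (mmap (in_alg A) monom_eval).
HB.instance Definition _ := GRing.isScalable.Build _ _ _ _ poly_eval
  poly_eval_scalable.

Lemma poly_evalX i : poly_eval << ucm i >> = v i.
Proof.
by rewrite /poly_eval mmapU /= scale1r mul1r /monom_eval mdomU big_seq_fset1
  cmUU expr1.
Qed.
End Evaluation.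

Notation ribbon_quot := {ideal_quot (ribbon_ideal : idealr zpoly)}.

Definition ribbon_hom : zpoly -> OmegaQ :=
  poly_eval (fun a => omegaQ_of (ribbonQ a)).
HB.instance Definition _ := GRing.LRMorphism.copy ribbon_hom
  (poly_eval (fun a => omegaQ_of (ribbonQ a))).

Lemma ribbon_homX a : ribbon_hom (zvar a) = omegaQ_of (ribbonQ a).
Proof. by rewrite zvar.unlock; apply: poly_evalX. Qed.

(* Main.v *)
Require Import Defs.
From HB Require Import structures.
From mathcomp Require Import all_boot all_order all_algebra finmap.
From mathcomp Require Import boolp monalg.
From mathcomp Require Import zify ring.

Import GRing.Theory Num.Theory.
Local Open Scope ring_scope.
Local Open Scope quotient_scope.

(* The Hessenberg determinant of a ribbon, expanded along its first column,
   gives [r_(a b s) = q_a r_(b s) - r_((a+b) s)], hence the product rule by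
   induction on the number of rows.  The coefficient of [x^m] in [q_n] is
   [2^|supp m|] when [deg m = n], so [n q_n = sum_(k odd) 2 p_k q_(n-k)] for the
   power sums [p_k]; as only odd k occur, [q(t) q(-t)] has derivative 0, which is
   the Euler relation.

   Conversely, modulo the ideal every [z_a] is a polynomial in the [z_n], and
   [z(t) z(-t) = 1] makes the logarithmic derivative of [z(t)] odd, so its odd
   coefficients generate the quotient (n being invertible in Q).  They are mapped
   to the [2 p_k], k odd, which are algebraically independent: a product of l
   power sums only involves monomials in at most l variables, and those in
   exactly l variables determine the factors. *)

(** * The coefficients of [q_n] *)

Lemma le_letter_total : total le_letter.
Proof. by move=> [i b] [j c]; rewrite /le_letter /=; case: b c => [] []; lia. Qed.

Lemma le_letter_trans : transitive le_letter.
Proof.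
by move=> [j c] [i b] [k d]; rewrite /le_letter /=; case: b c d => [] [] []; lia.
Qed.

Lemma le_letter_anti : antisymmetric le_letter.
Proof.
move=> [i b] [j c]; rewrite /le_letter /= => h.
by have [-> ->] : i = j /\ b = c by move: h; case: b c => [] []; lia.
Qed.

Lemma weightE (w : seq letter) i : weight w i = count (fun x => x.1 == i) w.
Proof.
rewrite /weight; elim: w => [|x w IH]; first by rewrite big_nil cm1.
by rewrite big_cons cmM IH cmU /=.
Qed.

Lemma count_letter (w : seq letter) i :
  count (fun x => x.1 == i) w
    = (count_mem (i, true) w + count_mem (i, false) w)%N.
Proof.
elim: w => //= [[j b] w ->]; rewrite !xpair_eqE /=.
by case: b; rewrite ?andbT ?andbF; lia.
Qed.

Lemma size_weight (w : seq letter) : size w = mdeg (weight w).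
Proof.
rewrite /weight mdeg_prod; elim: w => [|x w IH]; first by rewrite big_nil.
by rewrite big_cons /= mdegU IH.
Qed.

(* Sorting this word gives the only row filling of weight m whose primed
   letters lie exactly over S. *)
Definition marked_word (m : {cmonom nat}) (S : {fset nat}) : seq letter :=
  flatten [seq (i, i \in S) :: nseq (m i).-1 (i, false) | i <- finsupp m].

Lemma count_marked_word m S x :
  count_mem x (marked_word m S)
    = if x.1 \in finsupp m then
        if x.2 then (x.1 \in S : nat) else (m x.1 - (x.1 \in S))%N
      else 0%N.
Proof.
case: x => i b /=; rewrite /marked_word count_flatten -map_comp sumnE big_map.
pose F (j : nat) := if j == i then
  if b then (i \in S : nat) else (m i - (i \in S))%N else 0%N.
rewrite big_seq (eq_bigr F) => [|j jm]; last first.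
  rewrite /F /= count_nseq /= !xpair_eqE; move: jm; rewrite -cmE_neq0.
  by case: (eqVneq j i) => [->|//]; case: (m i) => // k _;
    case: {F} b; case: (i \in S) => /=; lia.
rewrite -big_seq /F; have [im|im] := boolP (i \in finsupp m); last first.
  by rewrite big_seq big1// => j jm; case: eqP => // ji; rewrite ji (negPf im) in jm.
rewrite (big_fsetD1 i)//= eqxx big1_fset ?addn0// => j.
by rewrite !inE => /andP[/negPf ->].
Qed.

Lemma weight_marked_word (m : {cmonom nat}) (S : {fset nat}) :
  (S `<=` finsupp m)%fset -> weight (marked_word m S) = m.
Proof.
move=> Sm; apply/eqP/cmP => i; rewrite weightE count_letter !count_marked_word /=.
have [im|] := boolP (i \in finsupp m); last by rewrite -cmE_eq0 => /eqP ->.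
move: im; rewrite -cmE_neq0; case: (m i) => // k _.
by case: (i \in S) => /=; lia.
Qed.

Lemma weight_perm (v w : seq letter) : perm_eq v w -> weight v = weight w.
Proof. exact: perm_big. Qed.

(** A row filling of weight [m] is determined by the set of [i] whose primed letter occurs, and
    every subset of the support of [m] arises. *)
Lemma qrowE n m : qrow n m = ((mdeg m == n) * 2 ^ #|` finsupp m|)%N%:Z.
Proof.
pose W S := sort le_letter (marked_word m S).
have cW S x : count_mem x (W S) = count_mem x (marked_word m S).
  by apply/permP; rewrite perm_sort.
have wW S : (S `<=` finsupp m)%fset -> weight (W S) = m.
  move=> Sm; rewrite -[RHS](weight_marked_word m S)//.
  by apply: weight_perm; rewrite perm_sort.
have fW S : row_filling (W S).
  rewrite /row_filling (sort_sorted le_letter_total); apply/allP => -[i b] _ /=.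
  apply/implyP => b1; rewrite cW count_marked_word /= b1.
  by case: (_ \in _) => //; case: (_ \in _).
have [nm|nm] := eqVneq (mdeg m) n; last first.
  apply: (@qrow_count _ _ [::]) => // w; rewrite in_nil; apply/esym/negP.
  by move=> /and3P[/eqP sw _ /eqP wm]; case/eqP: nm; rewrite -wm -size_weight.
rewrite mul1n -card_fpowerset.
rewrite (@qrow_count _ _ [seq W U | U <- fpowerset (finsupp m)]) ?size_map//.
  rewrite map_inj_in_uniq ?fset_uniq// => U T; rewrite !fpowersetE => Um Tm UT.
  (* The set [V] is read off from [W V] as the [i] whose primed letter occurs. *)
  have inW i V : (V `<=` finsupp m)%fset -> count_mem (i, true) (W V) = (i \in V).
    move=> Vm; rewrite cW count_marked_word /=.
    case: ifPn => // im; case: (boolP (i \in V)) => // /(fsubsetP Vm).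
    by rewrite (negPf im).
  apply/fsetP => i; have := inW i T Tm; rewrite -UT inW//.
  by case: (i \in U); case: (i \in T).
move=> w; apply/mapP/and3P => [[U]|[/eqP sw /andP[w_sorted w_once] /eqP ww]].
  by rewrite fpowersetE => Um ->; rewrite fW wW// size_weight wW// nm !eqxx.
pose S := [fset i in finsupp m | (i, true) \in w]%fset.
have Sm : (S `<=` finsupp m)%fset by apply/fsubsetP => i; rewrite !inE => /andP[].
exists S; first by rewrite fpowersetE.
(* Two sorted words agree once their letter multiplicities do. *)
apply: (sorted_eq le_letter_trans le_letter_anti) => //.
  exact: (sort_sorted le_letter_total).
rewrite perm_sym perm_sort; apply/allP => -[i b] _ /=.
rewrite count_marked_word /=; apply/eqP.
have mi : m i = (count_mem (i, true) w + count_mem (i, false) w)%N.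
  by rewrite -count_letter -weightE ww.
have ct : count_mem (i, true) w = ((i, true) \in w).
  have [iw|/count_memPn//] := boolP ((i, true) \in w).
  have c1 : (count_mem (i, true) w <= 1)%N := allP w_once _ iw.
  have c0 : (0 < count_mem (i, true) w)%N by rewrite -has_count has_pred1.
  by apply/eqP; rewrite eqn_leq c1 c0.
have iS : (i \in S) = ((i, true) \in w).
  by rewrite !inE /= -cmE_neq0 -lt0n mi ct andb_idl// => ->; rewrite add1n.
rewrite iS -ct; case: ifPn => [_|].
  by case: b; rewrite // mi addKn.
rewrite -cmE_eq0 mi addn_eq0 => /andP[/eqP ct0 /eqP cf0].
by case: b; rewrite ?ct0 ?cf0.
Qed.

(** * Newton identities *)

Section Convolution.
Context {R : comNzRingType}.
Implicit Types f g h : nat -> R.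

(** A sequence stands for its generating series in [t]: [conv] is the product, [alt] substitutes
    [-t], and [wt] is the derivation [t d/dt]. *)
Definition conv f g n : R := \sum_(i < n.+1) f i * g (n - i)%N.
Definition alt f n : R := (-1) ^+ n * f n.
Definition wt f n : R := f n *+ n.

Lemma eq_conv f f' g g' n :
    (forall i, (i <= n)%N -> f i = f' i) ->
    (forall i, (i <= n)%N -> g i = g' i) ->
  conv f g n = conv f' g' n.
Proof.
move=> ff' gg'; apply: eq_bigr => i _.
by rewrite ff' ?gg' ?leq_subr// -ltnS.
Qed.

(** Truncation to polynomials lets [convC] and [convA] inherit the ring laws of polynomials. *)
Lemma conv_coef f g (N i : nat) : (i < N)%N ->
  conv f g i = ((\poly_(j < N) f j) * (\poly_(j < N) g j))`_i.
Proof.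
move=> iN; rewrite coefM; apply: eq_bigr => j _.
rewrite !coef_poly (leq_ltn_trans _ iN) ?(leq_ltn_trans _ iN) ?leq_subr//.
by rewrite -ltnS.
Qed.

Lemma convC f g n : conv f g n = conv g f n.
Proof. by rewrite !(@conv_coef _ _ n.+1)// mulrC. Qed.

Lemma convA f g h n : conv f (conv g h) n = conv (conv f g) h n.
Proof.
have coef_conv f' g' i : (i <= n)%N ->
    conv f' g' i = (\poly_(j < n.+1) conv f' g' j)`_i.
  by move=> le_in; rewrite coef_poly ltnS le_in.
pose F := \poly_(j < n.+1) f j; pose G := \poly_(j < n.+1) g j.
pose H := \poly_(j < n.+1) h j.
transitivity ((F * (G * H))`_n).
  rewrite coefM; apply: eq_bigr => i _; rewrite coef_poly ltn_ord.
  by rewrite (@conv_coef g h n.+1)// ltnS leq_subr.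
rewrite mulrA coefM; apply: eq_bigr => i _; rewrite coef_poly ltnS leq_subr.
by rewrite (@conv_coef f g n.+1).
Qed.

Lemma conv1 f n : conv f (fun i => (i == 0)%:R) n = f n.
Proof.
rewrite /conv big_ord_recr /= subnn mulr1 big1 ?add0r// => i _.
by rewrite subn_eq0 leqNgt ltn_ord mulr0.
Qed.

Lemma conv_alt f g n : conv (alt f) (alt g) n = alt (conv f g) n.
Proof.
rewrite /alt /conv mulr_sumr; apply: eq_bigr => i _.
by rewrite mulrACA -exprD subnKC // -ltnS.
Qed.

Lemma altK f n : alt (alt f) n = f n.
Proof. by rewrite /alt mulrA -exprMn mulrNN mulr1 expr1n mul1r. Qed.

Lemma wt_alt f n : wt (alt f) n = alt (wt f) n.
Proof. by rewrite /wt /alt mulrnAr. Qed.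

Lemma wt_conv f g n : wt (conv f g) n = conv (wt f) g n + conv f (wt g) n.
Proof.
rewrite /wt /conv -sumrMnl -big_split; apply: eq_bigr => i _ /=.
by rewrite mulrnAl mulrnAr -mulrnDr subnKC // -ltnS.
Qed.

End Convolution.

Lemma rat_mulrn_eq0 (A : comAlgType rat) (x : A) n : x *+ n.+1 = 0 -> x = 0.
Proof.
move=> xn; apply: (@scalerI _ _ (n.+1%:R : rat)); first by rewrite pnatr_eq0.
by rewrite scaler_nat xn scaler0.
Qed.

Section NewtonIdentities.
Context {A : comAlgType rat}.
Variable z : nat -> A.

(* The coefficients of [t z'(t) z(-t)]; when [z(t) z(-t) = 1] this is the
   logarithmic derivative of z, so these are the power sums attached to z. *)
Definition newton_sum n := conv (wt z) (alt z) n.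

(* Differentiating [z(t) z(-t)] gives 0. *)
Lemma newton_euler (p : nat -> A) :
    z 0 = 1 -> (forall n, ~~ odd n -> p n = 0) ->
    (forall n, wt z n = conv p z n) ->
  forall n, conv (alt z) z n = (n == 0)%:R.
Proof.
move=> z0 p0 pz [|n]; first by rewrite /conv big_ord1 /alt expr0 mul1r z0 mulr1.
apply: (@rat_mulrn_eq0 _ _ n); change (wt (conv (alt z) z) n.+1 = 0).
rewrite wt_conv.
(* As [p] is odd, substituting [-t] in [wt z = p z] gives [wt (alt z) = - p (alt z)]. *)
have -> : conv (wt (alt z)) z n.+1 = - conv p (conv (alt z) z) n.+1.
  rewrite convA -mulN1r [in RHS]/conv mulr_sumr; apply: eq_bigr => i _.
  rewrite [RHS]mulrA; congr (_ * _); rewrite wt_alt /alt pz -/(alt (conv p z) i).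
  rewrite -conv_alt /conv mulr_sumr; apply: eq_bigr => j _.
  rewrite [RHS]mulrA; congr (_ * _); rewrite /alt.
  have [oj|ej] := boolP (odd j); first by rewrite -signr_odd oj expr1.
  by rewrite p0 ?mulr0.
(* The other summand is also the product of [p], [alt z] and [z], with the opposite sign. *)
rewrite [X in _ + X](@eq_conv _ _ (alt z) _ (conv p z))//.
rewrite [X in _ + X]convA [X in _ + X](@eq_conv _ _ (conv p (alt z)) _ z)//.
  by rewrite -convA addNr.
by move=> i _; rewrite convC.
Qed.

(** Multiplying [wt z = p z] by [alt z], the inverse of [z], isolates [p]. *)
Lemma newton_sum_unique (p : nat -> A) :
    (forall n, conv (alt z) z n = (n == 0)%:R) ->
    (forall n, wt z n = conv p z n) ->
  forall n, newton_sum n = p n.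
Proof.
move=> ez pz n; rewrite /newton_sum.
rewrite (@eq_conv _ _ (conv p z) _ (alt z)) => [|i _|//]; last by rewrite pz.
rewrite -convA -[RHS]conv1; apply: eq_conv => // i _.
by rewrite convC ez.
Qed.

(** Newton's recursion, by cancelling [alt z] against [z]; it recovers [z] from its Newton sums in
    [podd_generate]. *)
Lemma conv_newton_sum :
    (forall n, conv (alt z) z n = (n == 0)%:R) ->
  forall n, conv newton_sum z n = wt z n.
Proof. by move=> ez n; rewrite -convA -[RHS]conv1; apply: eq_conv. Qed.

(** Differentiating [z(-t) z(t) = 1] shows that the Newton series and its image under [alt] add up
    to 0; in even degree the two coefficients coincide. *)
Lemma newton_sum_even n : (forall n, conv (alt z) z n = (n == 0)%:R) ->
  ~~ odd n -> newton_sum n = 0.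
Proof.
move=> ez en; apply: (@rat_mulrn_eq0 _ _ 1).
have : wt (conv (alt z) z) n = 0.
  by rewrite /wt ez; case: (n) => [|k]; rewrite ?mulr0n ?mul0rn.
rewrite wt_conv [X in _ + X]convC mulr2n => <-.
congr (_ + _).
rewrite [RHS]convC [RHS](@eq_conv _ z (alt (alt z)) _ (alt (wt z))).
- by rewrite conv_alt /alt -signr_odd (negPf en) mul1r [RHS]convC.
- by move=> i _; rewrite altK.
- by move=> i _; rewrite wt_alt.
Qed.

(** The series [z(-t) z(t)] is invariant under [t -> -t], so its odd coefficients vanish
    automatically. *)
Lemma euler_even_all : z 0 = 1 ->
    (forall m, (0 < m)%N -> conv (alt z) z (2 * m) = 0) ->
  forall n, conv (alt z) z n = (n == 0)%:R.
Proof.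
move=> z0 ez n; have [on|en] := boolP (odd n); last first.
  case: n en => [|n] en; first by rewrite /conv big_ord1 /alt expr0 mul1r z0 mulr1.
  by have := ez n.+1./2; rewrite mul2n even_halfK//; apply; case: (n) en.
have -> : (n == 0)%:R = 0 :> A by case: (n) on.
apply: (@rat_mulrn_eq0 _ _ 1); rewrite mulr2n.
rewrite [X in X + _]convC.
rewrite [X in X + _](@eq_conv _ z (alt (alt z)) _ (alt z)) => [|i _|//].
  by rewrite conv_alt /alt -signr_odd on expr1 mulN1r addNr.
by rewrite altK.
Qed.

End NewtonIdentities.

(** * Power sums *)

Definition xpow (i k : nat) : {cmonom nat} := [cmonom k | _ in [fset i]]%M.

Lemma xpowE i k j : xpow i k j = if j == i then k else 0%N.
Proof. by rewrite /xpow cmE fsfun_fun inE. Qed.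

Lemma finsupp_xpow i k : (0 < k)%N -> finsupp (xpow i k) = [fset i]%fset.
Proof.
move=> k0; apply/fsetP => j; rewrite -cmE_neq0 xpowE inE.
by have [_|_] := eqVneq j i; case: k k0.
Qed.

Lemma mdeg_xpow i k : mdeg (xpow i k) = k.
Proof.
case: k => [|k]; last by rewrite mdegE finsupp_xpow// big_seq_fset1 xpowE eqxx.
by apply/eqP; rewrite mdeg_eq0; apply/cmP => j; rewrite xpowE cm1 if_same.
Qed.

Lemma xpow_inj k : (0 < k)%N -> injective (xpow^~ k).
Proof.
move=> k0 i j /(congr1 (fun d : {cmonom nat} => d i)); rewrite !xpowE eqxx.
by case: eqP => // _ kE; rewrite kE in k0.
Qed.

Lemma xpow_dvd i k (m : {cmonom nat}) :
  (xpow i k \in mdivs m) = (k <= m i)%N.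
Proof.
apply/mdivsP/idP => [/(_ i)|kmi j]; first by rewrite xpowE eqxx.
by rewrite xpowE; case: eqP => // ->.
Qed.

(** For [k > 0] the two conditions single out the monomials [x_i^k], so this is the power sum in
    infinitely many variables. *)
Definition psum (k : nat) : pseries nat rat :=
  fun m => ((#|` finsupp m| == 1) && (mdeg m == k))%:R.

Lemma psumP k (m : {cmonom nat}) : (0 < k)%N ->
  reflect (exists i, m = xpow i k) ((#|` finsupp m| == 1) && (mdeg m == k)).
Proof.
move=> k0; apply: (iffP andP) => [[/cardfs1P[i mi] /eqP mk]|[i ->]]; last first.
  by rewrite finsupp_xpow// cardfs1 mdeg_xpow !eqxx.
exists i; apply/eqP/cmP => j; rewrite xpowE.
case: eqP => [->|/eqP ji]; first by rewrite -mk mdegE mi big_seq_fset1.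
by apply/eqP; rewrite cmE_eq0 mi inE.
Qed.

Lemma psumM k (f : pseries nat rat) m : (0 < k)%N ->
  (psum k * f) m = \sum_(i <- finsupp m | (k <= m i)%N) f (divcm m (xpow i k)).
Proof.
move=> k0.
have -> : (psum k * f) m = \sum_(d <- mdivs m) psum k d * f (divcm m d) by [].
pose c (d : {cmonom nat}) := (#|` finsupp d| == 1) && (mdeg d == k).
transitivity (\sum_(d <- mdivs m | c d) f (divcm m d)).
  rewrite [RHS]big_mkcond; apply: eq_bigr => d _; rewrite /psum -/(c d).
  by case: (c d); rewrite ?mul1r ?mul0r.
rewrite big_fset_condE [RHS]big_fset_condE.
have -> : [fset d | d in mdivs m & c d]%fset
    = [fset xpow i k | i in [fset i in finsupp m | (k <= m i)%N]]%fset.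
  apply/fsetP => d; rewrite !inE; apply/andP/imfsetP => /= [[dm /psumP]|].
    move=> /(_ k0)[i di]; exists i => //; move: dm; rewrite di xpow_dvd => km.
    by rewrite !inE km andbT -cmE_neq0 -lt0n (leq_trans k0).
  move=> [i]; rewrite !inE => /andP[_ km] ->; rewrite xpow_dvd km.
  by split=> //; apply/psumP => //; exists i.
by rewrite big_imfset//= => i j _ _ /xpow_inj; apply.
Qed.

(** The variable [i] leaves the support exactly when its exponent is used up; this governs the
    powers of 2 in [qser_newton] and the variable count in [psum_prod_support]. *)
Lemma finsupp_div_xpow (m : {cmonom nat}) i k : i \in finsupp m ->
  (k <= m i)%N ->
  finsupp (divcm m (xpow i k))
    = if m i == k then (finsupp m `\ i)%fset else finsupp m.
Proof.
move=> im km; apply/fsetP => j; rewrite -cmE_neq0 divcmE xpowE.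
have [->|ji] := eqVneq j i; last first.
  by rewrite subn0 cmE_neq0; case: ifP => _; rewrite ?inE ?ji.
have [->|mk] := eqVneq (m i) k; first by rewrite subnn in_fsetD1 !eqxx.
have : (0 < m i - k)%N by rewrite subn_gt0 ltn_neqAle eq_sym mk.
by rewrite im; case: (m i - k)%N.
Qed.

Lemma mdeg_div (m d : {cmonom nat}) :
  d \in mdivs m -> (mdeg (divcm m d) + mdeg d)%N = mdeg m.
Proof. by move=> dm; rewrite addnC -mdegM mdivs_divK. Qed.

Lemma leq_mdeg (m : {cmonom nat}) i : (m i <= mdeg m)%N.
Proof.
have [im|] := boolP (i \in finsupp m); last by rewrite -cmE_eq0 => /eqP ->.
by rewrite mdegE (big_fsetD1 i)//= leq_addr.
Qed.

Lemma ps_coef_sum (I : choiceType) (R : comNzRingType) (J : Type) (r : seq J)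
    (P : pred J) (F : J -> pseries I R) m :
  (\sum_(j <- r | P j) F j) m = \sum_(j <- r | P j) F j m.
Proof. exact: (big_morph (fun f : pseries I R => f m)). Qed.

Lemma ps_coefMn (I : choiceType) (R : comNzRingType) (f : pseries I R) n m :
  (f *+ n) m = f m *+ n.
Proof. by elim: n => // n IH; rewrite !mulrS -IH. Qed.

(** * The Newton identity for the series [q_n] *)

Definition qser (n : nat) : pseries nat rat :=
  fun m => ((mdeg m == n) * 2 ^ #|` finsupp m|)%N%:R.

(** The coefficients of [t q'(t) / q(t)] for [q(t) = prod_i (1 + x_i t) / (1 - x_i t)]. *)
Definition odd_psum (k : nat) : pseries nat rat :=
  if odd k then psum k *+ 2 else 0.

Lemma sum_odd_ltn a : (\sum_(k < a | odd k) 2 = a./2.*2)%N.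
Proof.
elim: a => [|a IH]; first by rewrite big_ord0.
by rewrite big_mkcond big_ord_recr -big_mkcond /= IH; case: ifP; lia.
Qed.

(** The odd [k < a] contribute [2 * 2 ^ s] each, altogether [a./2.*2 * 2 ^ s]; the term [k = a],
    present when [a] is odd, contributes a single [2 ^ s]. *)
Lemma sum_odd_pow2 (n a s : nat) : (0 < s)%N -> (a <= n)%N ->
  (\sum_(k < n.+1 | odd k && (k <= a)) 2 * 2 ^ (s - (a == k)) = a * 2 ^ s)%N.
Proof.
move=> s0 an.
rewrite (eq_bigl (fun k : 'I_n.+1 => odd k && (k < a.+1)%N)) => [|k //].
rewrite -(big_ord_widen_cond n.+1 (fun k => odd k)
  (fun k => (2 * 2 ^ (s - (a == k)))%N))// big_mkcond big_ord_recr -big_mkcond /=.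
rewrite (eq_bigr (fun=> (2 * 2 ^ s)%N)) => [|k _]; last first.
  by rewrite (gtn_eqF (ltn_ord k)) subn0.
rewrite -big_distrl /= sum_odd_ltn eqxx -expnS subn1 prednK//.
rewrite -[in RHS](odd_double_half a) mulnDl addnC.
by case: (odd a); rewrite ?mul1n ?mul0n.
Qed.

Lemma qser_newton n : wt qser n = conv odd_psum qser n.
Proof.
apply: psP => m; rewrite /wt ps_coefMn /conv ps_coef_sum.
have termE (k : 'I_n.+1) : (odd_psum k * qser (n - k)) m =
    (if odd k then \sum_(i <- finsupp m | (k <= m i)%N)
       (mdeg m == n) * (2 * 2 ^ (#|` finsupp m| - (m i == k)))%N else 0)%N%:R.
  rewrite /odd_psum; case: ifP => ok; last by rewrite mul0r.
  rewrite mulrnAl ps_coefMn psumM ?odd_gt0//.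
  rewrite /qser -natr_sum -mulrnA mulnC; congr _%:R; rewrite big_distrr /=.
  rewrite big_seq_cond [RHS]big_seq_cond; apply: eq_bigr => i /andP[im km].
  rewrite mulnCA finsupp_div_xpow//; congr (_ * (2 * 2 ^ _))%N.
    have kn : (k <= n)%N by rewrite -ltnS.
    rewrite -(eqn_add2r (mdeg (xpow i k))) mdeg_div ?xpow_dvd//.
    by rewrite mdeg_xpow subnK.
  by case: eqP => _; rewrite ?subn0// [in RHS](cardfsD1 i) im addKn.
under [RHS]eq_bigr do rewrite termE.
rewrite -natr_sum /qser -mulrnA; congr _%:R.
have [mn|mn] := eqVneq (mdeg m) n; last first.
  by rewrite mul0n big1// => k _; case: ifP => // _; rewrite big1.
rewrite mul1n -big_mkcond /=.
(* The factor [n] is the sum of the exponents of [m], so it suffices to match the contribution of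
   each variable [i]. *)
rewrite (exchange_big_dep predT)//= -{1}mn mdegE big_distrr /=.
rewrite big_seq [RHS]big_seq; apply: eq_bigr => i im.
rewrite mulnC -(@sum_odd_pow2 n (m i)) ; last 2 first.
- by rewrite cardfs_gt0; apply/fset0Pn; exists i.
- by rewrite -mn leq_mdeg.
by apply: eq_bigr => k _; rewrite mul1n.
Qed.

Lemma ps_coef1 (I : choiceType) (R : comNzRingType) (m : {cmonom I}) :
  (1 : pseries I R) m = (m == mone)%:R.
Proof. by []. Qed.

(** * Algebraic independence of the odd power sums *)

(** Nonnegativity excludes cancellation when [psum_prod_gt0] exhibits a positive term. *)
Lemma psum_prod_ge0 (v : seq nat) m : all (ltn 0) v ->
  0 <= (\prod_(k <- v) psum k) m.
Proof.
elim: v m => [|k v IH] m /=; first by rewrite big_nil ps_coef1.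
by move=> /andP[k0 v0]; rewrite big_cons psumM// sumr_ge0// => i _; apply: IH.
Qed.

(** Each factor [psum k] contributes some [x_i^k], hence at most one new variable; with as many
    variables as factors, no two factors share a variable and the exponents are the indices. *)
Lemma psum_prod_support (v : seq nat) m :
    all (ltn 0) v -> (\prod_(k <- v) psum k) m != 0 ->
  (#|` finsupp m| <= size v)%N /\
  (#|` finsupp m| = size v -> perm_eq [seq m i | i <- finsupp m] v).
Proof.
elim: v m => [|k v IH] m /=.
  rewrite big_nil ps_coef1 => _.
  by have [->|_] := eqVneq m mone; rewrite ?eqxx// mdom1 cardfs0.
move=> /andP[k0 v0]; rewrite big_cons psumM//.
pose nz_at i := (\prod_(j <- v) psum j) (divcm m (xpow i k)) != 0.
have [/hasP[i im /andP[km nz]] _|/hasPn h] :=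
  boolP (has (fun i => (k <= m i)%N && nz_at i) (finsupp m)); last first.
  rewrite big_seq_cond big1 ?eqxx// => i /andP[im km]; apply/eqP.
  by have := h i im; rewrite /nz_at km negbK.
have [] := IH _ v0 nz; rewrite finsupp_div_xpow//.
have cm : #|` finsupp m| = (#|` finsupp m `\ i|).+1%fset by rewrite (cardfsD1 i) im.
case: eqP => [mk|_] le_v eq_v; last first.
  (* If [i] keeps a positive exponent, the support is already bounded by [size v], which excludes
     the equality case. *)
  by split=> [|cmv]; [apply: leqW | rewrite cmv ltnn in le_v].
split=> [|cmv]; first by rewrite cm ltnS.
have {}eq_v := eq_v (succn_inj (etrans (esym cm) cmv)).
have mE : perm_eq (finsupp m) (i :: (finsupp m `\ i)%fset).
  apply: uniq_perm; rewrite ?fset_uniq//= ?fset_uniq ?in_fsetD1 ?eqxx//.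
  by move=> j; rewrite inE in_fsetD1; case: eqVneq => // ->.
rewrite (perm_trans (perm_map _ mE))//= mk perm_cons -(permPr eq_v).
rewrite (@eq_in_map _ _ _ (divcm m (xpow i k)) _).1// => j.
by rewrite in_fsetD1 divcmE xpowE => /andP[/negPf -> _]; rewrite subn0.
Qed.

Lemma psum_prod_gt0 (v : seq nat) : all (ltn 0) v ->
  exists2 m : {cmonom nat}, #|` finsupp m| = size v & 0 < (\prod_(k <- v) psum k) m.
Proof.
elim: v => [|k v IH] /=.
  by exists mone; rewrite ?mdom1 ?cardfs0// big_nil ps_coef1 eqxx.
move=> /andP[k0 v0]; have [m mv m_gt0] := IH v0.
(* A variable beyond all those of [m], so that each factor gets its own. *)
pose i := (\max_(j <- finsupp m) j).+1.
have im : i \notin finsupp m.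
  apply/negP => im.
  have := @leq_bigmax_seq _ (enum_fset (finsupp m)) predT id i im isT.
  by rewrite ltnn.
have suppE : finsupp (mmul (xpow i k) m) = (i |` finsupp m)%fset.
  by rewrite mdomD finsupp_xpow.
have mi : mmul (xpow i k) m i = k.
  by rewrite cmM xpowE eqxx; move: im; rewrite -cmE_eq0 => /eqP ->; rewrite addn0.
exists (mmul (xpow i k) m); first by rewrite suppE cardfsU1 im mv.
(* Removing the new variable gives back the coefficient of [m]; the remaining terms are
   nonnegative. *)
rewrite big_cons psumM// suppE big_mkcond (big_fsetD1 i) ?fset1U1//= mi leqnn.
rewrite mul_divcmK ltr_wpDr// -big_mkcond sumr_ge0// => j _.
exact: psum_prod_ge0.
Qed.

(** Exponents become repetitions, so that a monomial in the power sums is a product over a list, the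
    form used in [psum_prod_support]. *)
Definition monom_word (M : {cmonom nat}) : seq nat :=
  flatten [seq nseq (M i) i | i <- finsupp M].

Lemma count_monom_word M i : count_mem i (monom_word M) = M i.
Proof.
rewrite /monom_word count_flatten -map_comp sumnE big_map.
under eq_bigr do rewrite /= count_nseq.
have [iM|iM] := boolP (i \in finsupp M); last first.
  rewrite big_seq big1 => [|j jM]; first by move: iM; rewrite -cmE_eq0 => /eqP.
  by rewrite /=; case: eqP => // ji; rewrite -ji jM in iM.
rewrite (big_fsetD1 i)//= eqxx mul1n big1_fset ?addn0// => j.
by rewrite !inE => /andP[/negPf ->].
Qed.

Lemma size_monom_word M : size (monom_word M) = mdeg M.
Proof.
rewrite size_flatten /shape -map_comp sumnE big_map mdegE.
by apply: eq_bigr => i _; rewrite /= size_nseq.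
Qed.

Lemma monom_eval_word (K : comNzRingType) (A : comAlgType K) (v : nat -> A) M :
  monom_eval v M = \prod_(k <- monom_word M) v k.
Proof.
rewrite /monom_word big_flatten big_map; apply: eq_bigr => i _.
by rewrite big_nseq iter_mulr_1.
Qed.

(** For [M] of maximal degree in [P], some monomial [m] with exactly [mdeg M] variables occurs in
    the product of power sums attached to [M], and in no other product coming from [P]. *)
Lemma psum_alg_indep (P : {malg rat[{cmonom nat}]}) :
  poly_eval (fun k => psum k.*2.+1) P = 0 -> P = 0.
Proof.
move=> P0; apply/eqP/negP => /negP Pn0.
pose v M := [seq k.*2.+1 | k <- monom_word M].
have v_gt0 M : all (ltn 0) (v M) by apply/allP => _ /mapP[k _ ->].
have vE M : monom_eval (fun k => psum k.*2.+1) M = \prod_(k <- v M) psum k.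
  by rewrite monom_eval_word big_map.
have size_v M : size (v M) = mdeg M by rewrite size_map size_monom_word.
have v_inj M N : perm_eq (v M) (v N) -> M = N.
  (* Halving recovers [k] from [k.*2.+1]. *)
  move=> /(perm_map half); rewrite /v -!map_comp.
  rewrite !(eq_map (_ : _ =1 id)) => [|k|k]; rewrite /= ?uphalf_double//.
  rewrite !map_id => /permP MN; apply/eqP/cmP => i.
  by rewrite -!count_monom_word MN.
have [M MP Mmax] : exists2 M, M \in msupp P &
    forall N, N \in msupp P -> (mdeg N <= mdeg M)%N.
  pose Q n := has (fun M => mdeg M == n) (msupp P).
  have exQ : exists n, Q n.
    move: Pn0; rewrite -msupp_eq0 => /fset0Pn[M MP].
    by exists (mdeg M); apply/hasP; exists M.
  have ubQ n : Q n -> (n <= msize P)%N.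
    by move=> /hasP[M MP /eqP <-]; apply/ltnW/msize_mdeg_lt.
  case: (ex_maxnP exQ ubQ) => n /hasP[M MP /eqP Mn] nmax; exists M => // N NP.
  by rewrite Mn; apply: nmax; apply/hasP; exists N.
have [m mM m_gt0] := psum_prod_gt0 (v M) (v_gt0 M).
have /(congr1 (fun f : pseries nat rat => f m)) := P0.
rewrite /poly_eval mmapE ps_coef_sum (big_fsetD1 M)//= big1_fset => [|N].
  rewrite addr0 vE mulr_algl => /eqP; rewrite -[X in X == _]/(P@_M * _).
  by rewrite mulf_eq0 (negPf (lt0r_neq0 m_gt0)) orbF mcoeff_eq0 MP.
(* Were the coefficient nonzero, [N] would have as many factors as [M] by maximality, and the
   exponents of [m] would then identify the two. *)
rewrite in_fsetD1 => /andP[/eqP NM NP] _; rewrite vE mulr_algl.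
rewrite -[LHS]/(P@_N * _); apply/eqP; rewrite mulf_eq0; apply/orP; right.
apply/negPn/negP => /(psum_prod_support _ _ (v_gt0 N)); rewrite mM !size_v.
move=> [le_MN] perm_mN; have NM' : mdeg M = mdeg N.
  by apply/eqP; rewrite eqn_leq le_MN Mmax.
have [_ /(_ _)perm_mM] := psum_prod_support _ m (v_gt0 M) (lt0r_neq0 m_gt0).
apply/NM/v_inj; rewrite -(permPl (perm_mN NM')) perm_mM//.
Qed.

(** * Ribbon determinants *)

(** Defined on all lists, so that inductions need not carry proofs of [is_comp]. *)
Definition ribbon_det (s : seq nat) : Omega :=
  skew_det (ribbon_outer s) (ribbon_inner s).

(** Entries are indexed by natural numbers, so that minors arise by shifting indices. *)
Definition nat_det (R : comNzRingType) (n : nat) (h : nat -> nat -> R) : R :=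
  \det (\matrix_(i < n, j < n) h i j).

Lemma eq_nat_det (R : comNzRingType) n (h h' : nat -> nat -> R) :
  (forall i j, h i j = h' i j) -> nat_det R n h = nat_det R n h'.
Proof.
by move=> hh'; congr (\det _); apply/matrixP => i j; rewrite !mxE hh'.
Qed.

(** Only the first two entries of the first column can be nonzero; the minor of the second omits row
    1, whence its row index. *)
Lemma nat_det_hessenberg (R : comNzRingType) n (h : nat -> nat -> R) :
    h 1%N 0%N = 1 -> (forall i, (1 < i)%N -> h i 0%N = 0) ->
  nat_det R n.+2 h = h 0%N 0%N * nat_det R n.+1 (fun i j => h i.+1 j.+1)
    - nat_det R n.+1 (fun i j => h (if i is 0 then 0 else i.+1)%N j.+1).
Proof.
move=> h10 hi0; rewrite /nat_det (expand_det_col _ ord0) !big_ord_recl /=.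
rewrite [X in _ + (_ + X)]big1 ?addr0 => [|i _]; last first.
  by rewrite mxE hi0 ?mul0r.
rewrite !mxE h10 mul1r /cofactor /= expr0 mul1r expr1 mulN1r.
by congr (_ * _ - _); congr (\det _); apply/matrixP => i j; rewrite !mxE//=;
  case: i => [[|i] i_lt].
Qed.

Definition ribbon_entry (s : seq nat) (i j : nat) : Omega :=
  qfun ((nth 0%N (ribbon_outer s) i)%:Z - (nth 0%N (ribbon_inner s) j)%:Z
        - i%:Z + j%:Z).

Lemma ribbon_detE s : ribbon_det s = nat_det _ (size s) (ribbon_entry s).
Proof. by rewrite /ribbon_det /skew_det size_ribbon_outer. Qed.

Lemma ribbon_outer_le s i : all (ltn 0) s ->
  (nth 0 (ribbon_outer s) i <= head 0 (ribbon_outer s))%N.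
Proof.
elim: s i => [|a s IH] [|i] //= /andP[a0 s0]; apply: leq_trans (IH i s0) _.
by case: (ribbon_outer s) => //= x t; lia.
Qed.

Lemma ribbon_det1 a : ribbon_det [:: a.+1] = qfun a.+1.
Proof.
rewrite ribbon_detE /nat_det det_mx11 mxE /ribbon_entry; congr qfun => /=; lia.
Qed.

(** The first column reads [q_a], [q_0 = 1], then zeros; deleting it with row 0 leaves the ribbon of
    [b :: s], and deleting it with row 1 merges the rows [a] and [b]. *)
Lemma ribbon_det_rec a b s : all (ltn 0) [:: a, b & s] ->
  ribbon_det [:: a, b & s]
    = ribbon_det [:: a] * ribbon_det (b :: s) - ribbon_det ((a + b)%N :: s).
Proof.
move=> abs; have /and3P[a0 b0 s0] := abs.
have {}a0 : (0 < a)%N := a0; have {}b0 : (0 < b)%N := b0; rewrite !ribbon_detE /=.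
(* The inner length of the row [b]; the default 1 makes it 0 when [s] is empty. *)
set x := (head 1 (ribbon_outer s)).-1.
rewrite nat_det_hessenberg.
- have -> : nat_det _ 1 (ribbon_entry [:: a]) = ribbon_entry [:: a, b & s] 0 0.
    rewrite /nat_det det_mx11 mxE /ribbon_entry.
    by apply: (congr1 qfun); rewrite /= -/x; lia.
  rewrite (eq_nat_det _ _ _ (ribbon_entry (b :: s))) => [|i j]; last first.
    by rewrite /ribbon_entry; apply: (congr1 qfun); rewrite /= -/x; lia.
  rewrite [X in _ - X = _](eq_nat_det _ _ _ (ribbon_entry ((a + b)%N :: s)))//.
  by move=> [|i] [|j]; rewrite /ribbon_entry; apply: (congr1 qfun);
    rewrite /= -/x; lia.
- rewrite /ribbon_entry /= -/x.
  by have -> : (b + x)%:Z - (b + x).-1%:Z - 1%:Z + 0%:Z = 0 by lia.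
- move=> i i1; have := @ribbon_outer_le (b :: s) i.-1 (andP abs).2.
  rewrite /ribbon_entry; case: i i1 => // i i1 /=; rewrite -/x => le_o.
  (* Row [i] is no longer than row 1, which overlaps row 0 in one column, so the index is at most
     [1 - i]. *)
  set k := (X in qfun X); have : k < 0 by rewrite /k; lia.
  by case: k => // -[].
Qed.

Lemma ncat_cons a b s t : ncat (a :: b :: s) t = a :: ncat (b :: s) t.
Proof. by []. Qed.

Lemma ncat_headD a b s t :
  ncat ((a + b)%N :: s) t
    = (a + head 0 (ncat (b :: s) t))%N :: behead (ncat (b :: s) t).
Proof. by case: s => [|c s] //=; rewrite /ncat /= addnA. Qed.

(** For a single row this is [ribbon_det_rec]; otherwise that recursion reduces [s] to two lists
    with one row less, and the same recursion reassembles the right-hand side. *)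
Lemma ribbon_detM s t : s != [::] -> t != [::] ->
    all (ltn 0) s -> all (ltn 0) t ->
  ribbon_det s * ribbon_det t = ribbon_det (s ++ t) + ribbon_det (ncat s t).
Proof.
(* The induction is on the size, since [(a + b) :: s] is not a tail of the list. *)
move=> + t0 + t_gt0; have [k] := ubnP (size s).
elim: k s => // k IH [|a [|b s]] //= ks _.
  case: {IH} t t0 t_gt0 => // b t _ bt_gt0; rewrite andbT => a0.
  by rewrite ribbon_det_rec ?subrK//= a0.
move=> /and3P[a0 b0 s0].
have bs_gt0 : all (ltn 0) (b :: s) by rewrite /= b0.
have abs_gt0 : all (ltn 0) ((a + b)%N :: s) by rewrite /= addn_gt0 b0 orbT.
rewrite ribbon_det_rec /= ?a0 ?b0// mulrBl -mulrA.
rewrite (IH (b :: s) ks isT bs_gt0) (IH ((a + b)%N :: s) ks isT abs_gt0).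
have all_ncat : all (ltn 0) (ncat (b :: s) t).
  have bs_comp : is_comp (b :: s) := bs_gt0.
  have t_comp : is_comp t by rewrite /is_comp t0.
  by have /andP[] := is_comp_ncat (MkComposition bs_comp) (MkComposition t_comp).
rewrite ncat_cons [ribbon_det [:: a, b & s ++ t]]ribbon_det_rec; last first.
  by rewrite /= a0 b0 all_cat s0.
rewrite ncat_headD.
have [c [u cu]] : exists c u, ncat (b :: s) t = c :: u.
  by case: (s) => [|c' s']; eexists; eexists.
move: all_ncat; rewrite cu => /= /andP[c0 u0].
rewrite [ribbon_det [:: a, c & u]]ribbon_det_rec /= ?a0 ?c0//.
by ring.
Qed.

(** * The induced homomorphism *)

(** Identities between the [qser] can thus be pulled back along the injective [omega_emb]. *)
Lemma omega_emb_row n : omega_emb (ribbonQ_row n) = qser n.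
Proof.
apply: psP => m; case: n => [|n] /=.
  rewrite rmorph1 ps_coef1 /qser mdeg_eq0.
  by have [->|] := eqVneq m mone; rewrite ?mdom1 ?cardfs0.
by rewrite [ribbonQ _]ribbon_det1 /omega_emb /ps_map /= qrowE.
Qed.

Lemma qser_euler n : conv (alt qser) qser n = (n == 0)%:R.
Proof.
apply: (newton_euler _ odd_psum) qser_newton n => [|n].
  by rewrite -omega_emb_row rmorph1.
by rewrite /odd_psum => /negPf ->.
Qed.

Lemma qser_newton_sum n : newton_sum qser n = odd_psum n.
Proof. exact: newton_sum_unique qser_euler qser_newton n. Qed.

Lemma ribbonQ_euler m : (0 < m)%N ->
  \sum_(r < (2 * m).+1)
    (-1) ^+ r * ribbonQ_row r * ribbonQ_row (2 * m - r) = 0.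
Proof.
move=> m0; apply: omega_emb_inj; rewrite rmorph0 rmorph_sum /=.
transitivity (conv (alt qser) qser (2 * m)); last first.
  by rewrite qser_euler; case: m m0.
apply: eq_bigr => r _.
by rewrite 2!rmorphM rmorphXn rmorphN1 /= !omega_emb_row.
Qed.

Lemma ribbonQM a b :
  ribbonQ a * ribbonQ b = ribbonQ (cconc a b) + ribbonQ (nconc a b).
Proof.
by have /andP[a0 a_gt0] := valP a; have /andP[b0 b_gt0] := valP b;
  apply: ribbon_detM.
Qed.

Lemma ribbon_hom_row n : ribbon_hom (zvar_row n) = omegaQ_of (ribbonQ_row n).
Proof. by case: n => [|n] /=; rewrite ?rmorph1// ribbon_homX. Qed.

Lemma ribbon_hom_ideal p : ideal_gen ribbon_relation p -> ribbon_hom p = 0.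
Proof.
elim=> [{}p [a b|m m0]||x y _ x0 _ y0|a x _ x0].
- rewrite 2!rmorphB rmorphM /= !ribbon_homX -rmorphM ribbonQM rmorphD /=.
  by rewrite addrAC addrK subrr.
- have := congr1 omegaQ_of (ribbonQ_euler m m0).
  rewrite rmorph0 => eul; rewrite -[RHS]eul !rmorph_sum; apply: eq_bigr => r _.
  by rewrite !rmorphM !rmorphXn !rmorphN1 /= !ribbon_hom_row.
- exact: rmorph0.
- by rewrite rmorphD /= x0 y0 addr0.
- by rewrite rmorphM /= x0 mulr0.
Qed.

Local Notation piA := (\pi_ribbon_quot).

Lemma pi_eqP (p q : zpoly) :
  piA p = piA q <-> ideal_gen ribbon_relation (p - q).
Proof.
split=> [/eqP|h]; first by rewrite -Quotient.idealrBE => /asboolP.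
by apply/eqP; rewrite -Quotient.idealrBE; apply/asboolP.
Qed.

(** Evaluated on a chosen representative; [ribbon_quot_homE] gives independence of the choice. *)
Definition ribbon_quot_hom (x : ribbon_quot) : OmegaQ := ribbon_hom (repr x).

Lemma ribbon_quot_homE p : ribbon_quot_hom (piA p) = ribbon_hom p.
Proof.
apply/eqP; rewrite -subr_eq0 -rmorphB; apply/eqP/ribbon_hom_ideal/pi_eqP.
by rewrite reprK.
Qed.

Lemma ribbon_quot_hom_zmod_morphism : zmod_morphism ribbon_quot_hom.
Proof.
elim/quotW => p; elim/quotW => q; rewrite -rmorphB.
by rewrite !ribbon_quot_homE rmorphB.
Qed.
Lemma ribbon_quot_hom_monoid_morphism : monoid_morphism ribbon_quot_hom.
Proof.
split; first by rewrite -(rmorph1 piA) ribbon_quot_homE rmorph1.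
elim/quotW => p; elim/quotW => q; rewrite -rmorphM.
by rewrite !ribbon_quot_homE rmorphM.
Qed.
Lemma piZ c (p : zpoly) : piA (c *: p) = c *: piA p.
Proof. by apply/esym/pi_scale. Qed.
Lemma ribbon_quot_hom_scalable : scalable ribbon_quot_hom.
Proof.
by move=> c; elim/quotW => p; rewrite -piZ !ribbon_quot_homE linearZ.
Qed.

HB.instance Definition _ := GRing.isZmodMorphism.Build _ _ ribbon_quot_hom
  ribbon_quot_hom_zmod_morphism.
HB.instance Definition _ := GRing.isMonoidMorphism.Build _ _ ribbon_quot_hom
  ribbon_quot_hom_monoid_morphism.
HB.instance Definition _ := GRing.isScalable.Build _ _ _ _ ribbon_quot_hom
  ribbon_quot_hom_scalable.

(** * Generators of the quotient *)

Lemma rmorph_poly_eval (I : choiceType) (K : comNzRingType)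
    (A B : comAlgType K) (h : {lrmorphism A -> B}) (v : I -> A)
    (P : {malg K[{cmonom I}]}) :
  h (poly_eval v P) = poly_eval (fun i => h (v i)) P.
Proof.
rewrite /poly_eval !mmapE rmorph_sum; apply: eq_bigr => M _ /=.
rewrite !mulr_algl linearZ /= /monom_eval rmorph_prod; congr (_ *: _).
by apply: eq_bigr => i _; rewrite rmorphXn.
Qed.

Lemma rmorph_conv (A B : comNzRingType) (h : {rmorphism A -> B}) f g n :
  h (conv f g n) = conv (h \o f) (h \o g) n.
Proof. by rewrite /conv rmorph_sum; apply: eq_bigr => i _; rewrite rmorphM. Qed.

Lemma rmorph_newton_sum (A B : comAlgType rat) (h : {rmorphism A -> B}) z n :
  h (newton_sum z n) = newton_sum (h \o z) n.
Proof.
rewrite /newton_sum rmorph_conv; apply: eq_conv => i _ /=.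
  by rewrite /wt rmorphMn.
by rewrite /alt rmorphM rmorphXn rmorphN1.
Qed.

Lemma cmonom_split (I : choiceType) (M : {cmonom I}) : M != mone ->
  exists i N, M = mmul (ucm i) N.
Proof.
rewrite -mdeg_eq0 mdegE => M0.
have [M00|/fset0Pn[i iM]] := eqVneq (finsupp M) fset0.
  by rewrite M00 big_seq_fset0 in M0.
exists i, (divcm M (ucm i)); rewrite mdivs_divK//; apply/mdivsP => j.
by rewrite cmU; case: eqP => // <-; rewrite lt0n cmE_neq0.
Qed.

(** Monomials are reached by induction on the degree, then arbitrary polynomials as linear
    combinations. *)
Lemma malg_ind (I : choiceType) (K : comNzRingType)
    (S : {malg K[{cmonom I}]} -> Prop) :
    S 1 -> (forall i, S << ucm i >>) ->
    (forall c p q, S p -> S q -> S (c *: p + q)) ->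
    (forall p q, S p -> S q -> S (p * q)) ->
  forall p, S p.
Proof.
move=> S1 SX SZD SM p.
have S0 : S 0 by rewrite -(addNr 1) -scaleN1r; apply: SZD; exact: S1.
have SU M : S << M >>.
  have [n] := ubnP (mdeg M).
  elim: n M => [M /notF[]|n IH M].
  have [-> _|/cmonom_split[i [N ->]]] := eqVneq M mone; first exact: S1.
  rewrite mdegM mdegU add1n ltnS => Nn; rewrite -[1]mulr1 -fgmulUU -malgM_def.
  by apply: SM; [exact: SX | exact: IH].
rewrite [p]monalgE; elim: (enum_fset (msupp p)) => [|M s IH].
  by rewrite big_nil; exact: S0.
rewrite big_cons -[M in << _ *g M >>]mul1m -[p@_M]mulr1 -fgmulUU.
rewrite -malgM_def mul_malgC.
by apply: SZD; [exact: SU | exact: IH].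
Qed.

Definition zrow n : ribbon_quot := piA (zvar_row n).
(** The class that maps to the power sum of index [2k + 1]; the factor 1/2 compensates the 2 in
    [odd_psum]. *)
Definition podd k : ribbon_quot := 2%:R^-1 *: newton_sum zrow k.*2.+1.

Lemma zrow_euler n : conv (alt zrow) zrow n = (n == 0)%:R.
Proof.
apply: euler_even_all => [|m m0]; first exact: rmorph1.
transitivity (piA (euler_form (2 * m))).
  rewrite /euler_form rmorph_sum; apply: eq_bigr => r _.
  by rewrite 2!rmorphM rmorphXn rmorphN1.
rewrite -(rmorph0 piA); apply/pi_eqP; rewrite subr0.
exact/ideal_gen_in/ribbon_relation_euler.
Qed.

Lemma ribbon_quotM a b :
  piA (zvar a) * piA (zvar b) = piA (zvar (cconc a b)) + piA (zvar (nconc a b)).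
Proof.
rewrite -rmorphM -rmorphD; apply/pi_eqP; rewrite opprD addrA.
exact/ideal_gen_in/ribbon_relation_mul.
Qed.

(** Newton's recursion yields the one-row classes, the product relation then yields all ribbons, and
    these generate the quotient. *)
Lemma podd_generate (x : ribbon_quot) : exists P, x = poly_eval podd P.
Proof.
pose S x := exists P, x = poly_eval podd P.
have S1 : S 1 by exists 1; rewrite rmorph1.
have SZD c u v : S u -> S v -> S (c *: u + v).
  by move=> [P ->] [Q ->]; exists (c *: P + Q); rewrite linearP.
have SM u v : S u -> S v -> S (u * v).
  by move=> [P ->] [Q ->]; exists (P * Q); rewrite rmorphM.
have S0 : S 0 by rewrite -(addNr 1) -scaleN1r; apply: SZD.
have SZ c u : S u -> S (c *: u) by move=> Su; rewrite -[_ *: _]addr0; apply: SZD.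
have SB u v : S u -> S v -> S (u - v).
  by move=> Su Sv; rewrite addrC -scaleN1r; apply: SZD.
have Sy k : S (podd k) by exists << ucm k >>; rewrite poly_evalX.
have Snewton n : S (newton_sum zrow n).
  have [on|en] := boolP (odd n); last first.
    by rewrite newton_sum_even//; apply: zrow_euler.
  have -> : newton_sum zrow n = 2%:R *: podd n./2.
    by rewrite /podd odd_halfK// prednK ?odd_gt0// scalerA mulfV ?scale1r.
  exact: SZ.
have Srow n : S (zrow n).
  have [k] := ubnP n; elim: k n => // k IH [|n] nk; first by rewrite /zrow rmorph1.
  have -> : zrow n.+1 = n.+1%:R^-1 *: conv (newton_sum zrow) zrow n.+1.
    rewrite (conv_newton_sum _ zrow_euler) /wt -scaler_nat scalerA.
    by rewrite mulVf ?scale1r// pnatr_eq0.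
  (* The term of index 0 vanishes because 0 is even, so only rows shorter than [n.+1] remain. *)
  apply: SZ; rewrite /conv big_ord_recl newton_sum_even//; last exact: zrow_euler.
  rewrite mul0r add0r; apply: big_ind => [//|u v Su Sv|i _].
    by rewrite -(scale1r u); apply: SZD.
  by apply: SM => //; apply: IH; rewrite /= /bump; move: nk; lia.
(* Induction on the number of parts, through [z_(u v s) = z_u z_(v s) - z_((u+v) s)]. *)
have Scomp (a : composition) : S (piA (zvar a)).
  case: a => s; have [k] := ubnP (size s); elim: k s => // k IH s sk sP.
  case: s sk sP => [|u [|v s]] sk sP //.
    case: u sk sP => // u sk sP; have := Srow u.+1.
    by rewrite /zrow /= (_ : comp1 u = MkComposition sP)//; exact: val_inj.
  have /andP[_ /= /and3P[x0 y0 s0]] := sP.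
  have xP : is_comp [:: u] by rewrite /is_comp /= x0.
  have yP : is_comp (v :: s) by rewrite /is_comp /= y0.
  have xyP : is_comp ((u + v)%N :: s) by rewrite /is_comp /= addn_gt0 x0.
  have := ribbon_quotM (MkComposition xP) (MkComposition yP).
  rewrite (_ : cconc _ _ = MkComposition sP); last exact: val_inj.
  rewrite (_ : nconc _ _ = MkComposition xyP); last exact: val_inj.
  move/eqP; rewrite -subr_eq => /eqP <-.
  by apply: SB; [apply: SM|]; apply: IH; move: sk => /=; lia.
elim/quotW: x => p; elim/malg_ind: p => [|a|c p q Sp Sq|p q Sp Sq].
- by rewrite rmorph1.
- by have := Scomp a; rewrite zvar.unlock.
- by rewrite rmorphD /= piZ; apply: SZD.
- by rewrite rmorphM; apply: SM.
Qed.

(** * Bijectivity of the induced homomorphism *)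

Definition quot_series (x : ribbon_quot) : pseries nat rat :=
  val (ribbon_quot_hom x).

Lemma quot_series_zmod_morphism : zmod_morphism quot_series.
Proof. by move=> x y; rewrite /quot_series !rmorphB. Qed.
Lemma quot_series_monoid_morphism : monoid_morphism quot_series.
Proof. by split=> [|x y]; rewrite /quot_series ?rmorph1 ?rmorphM. Qed.
Lemma quot_series_scalable : scalable quot_series.
Proof. by move=> c x; rewrite /quot_series !linearZ. Qed.

HB.instance Definition _ := GRing.isZmodMorphism.Build ribbon_quot _ quot_series
  quot_series_zmod_morphism.
HB.instance Definition _ := GRing.isMonoidMorphism.Build ribbon_quot _ quot_series
  quot_series_monoid_morphism.
HB.instance Definition _ := GRing.isScalable.Build _ ribbon_quot _ _ quot_series
  quot_series_scalable.

Lemma quot_series_zrow n : quot_series (zrow n) = qser n.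
Proof.
by rewrite /quot_series ribbon_quot_homE ribbon_hom_row -omega_emb_row.
Qed.

Lemma quot_series_podd k : quot_series (podd k) = psum k.*2.+1.
Proof.
rewrite linearZ /= rmorph_newton_sum (_ : _ \o _ = qser); last first.
  by apply: funext => n; rewrite /= quot_series_zrow.
rewrite qser_newton_sum /odd_psum /= odd_double /= -scaler_nat scalerA.
by rewrite mulVf ?scale1r.
Qed.

(** Written as a polynomial in the [podd], [x] maps to the same polynomial in the odd power sums,
    which are algebraically independent. *)
Lemma ribbon_quot_hom_eq0 x : ribbon_quot_hom x = 0 -> x = 0.
Proof.
move=> gx0; have : quot_series x = 0 by rewrite /quot_series gx0 rmorph0.
have [P ->] := podd_generate x; rewrite rmorph_poly_eval.
rewrite (_ : (fun k => _) = fun k => psum k.*2.+1); last first.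
  by apply: funext => k; apply: quot_series_podd.
by move=> /psum_alg_indep ->; rewrite rmorph0.
Qed.

Lemma ribbon_hom_surj (y : OmegaQ) : exists p, ribbon_hom p = y.
Proof.
have [N [[f f_omega] ->]] := OmegaQ_fracP y.
suff [p fp] : exists p,
    val (ribbon_hom p) = ps_map (intr : {rmorphism int -> rat}) f.
  by exists (N.+1%:R^-1 *: p); rewrite linearZ; congr (_ *: _); apply: val_inj.
move/asboolP: f_omega.
(* Induction on the generation of the subring: its generators [q_n] are one-row ribbons. *)
elim=> [_ [n ->]||f1 g _ [p pf] _ [q qg]|f1 g _ [p pf] _ [q qg]].
- exists (zvar_row n.+1); rewrite ribbon_hom_row /= /omega_emb.
  by rewrite [ribbonQ _]ribbon_det1.
- by exists 1; rewrite !rmorph1.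
- by exists (p - q); rewrite !rmorphB /= pf qg.
- by exists (p * q); rewrite !rmorphM /= pf qg.
Qed.

Theorem theorem3p8 :
  [/\ exists2 g : {lrmorphism ribbon_quot -> OmegaQ},
        bijective g
        & forall p : zpoly, g (\pi_ribbon_quot p) = ribbon_hom p,
      forall p : zpoly, ribbon_hom p = 0 <-> ideal_gen ribbon_relation p,
      forall a b : composition,
        ribbonQ a * ribbonQ b = ribbonQ (cconc a b) + ribbonQ (nconc a b)
    & forall m : nat, (0 < m)%N ->
        \sum_(r < (2 * m).+1)
          (-1) ^+ r * ribbonQ_row r * ribbonQ_row (2 * m - r) = 0].
Proof.
have g_inj : injective ribbon_quot_hom.
  by apply: raddf_inj; exact: ribbon_quot_hom_eq0.
split; last exact: ribbonQ_euler.
- exists ribbon_quot_hom; last exact: ribbon_quot_homE.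
  have /choice[h hP] : forall y, exists x, ribbon_quot_hom x = y.
    move=> y; have [p <-] := ribbon_hom_surj y.
    by exists (piA p); exact: ribbon_quot_homE.
  by exists h => // x; apply: g_inj; rewrite hP.
- move=> p; split=> [|/ribbon_hom_ideal//]; rewrite -ribbon_quot_homE.
  move=> /ribbon_quot_hom_eq0; rewrite -(rmorph0 piA) => /pi_eqP.
  by rewrite subr0.
- exact: ribbonQM.
Qed.
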